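(* Let $B_1, \dots, B_k$ be nonempty sets forming a partition of $[n]$, let $A_1, \dots, A_m \in \mathcal{S}^n$ be block matrices with respect to $B_1, \dots, B_k$, and let $t \geq 0$ be an integer. The following two conditions are equivalent: (i) for all positive semidefinite block matrices $X^0 \in \mathcal{S}^n$ with $\sigma^B_+(X^0) \leq t$, the set $$\{ X \succeq 0 : X \in \mathcal{S}^n \text{ a block matrix},\ A_i \bullet X = A_i \bullet X^0 \text{ for all } i \in [m] \}$$ is a singleton; (ii) for all symmetric block matrices $V \in \mathcal{S}^n$, $V \neq 0$, with $A_i \bullet V = 0$ for all $i \in [m]$, we have $\sigma^B_+(V) > t$ and $\sigma^B_-(V) > t$.
   Context: $\mathcal{S}^n$ is the set of real symmetric $n \times n$ matrices, $[n] = \{1,\dots,n\}$, $\succeq 0$ means positive semidefinite, and $A \bullet B = \mathrm{tr}(A^\top B)$. A matrix $M \in \mathcal{S}^n$ is a block matrix with respect to a partition $B_1, \dots, B_k$ of $[n]$ if $M_{st} = 0$ for all $(s,t) \notin (B_1 \times B_1) \cup \dots \cup (B_k \times B_k)$. $M_{B_i}$ denotes the submatrix with rows and columns indexed by $B_i$. For a block matrix $M \in \mathcal{S}^n$, $\sigma^B_+(M)$ is the number of $i \in [k]$ such that $M_{B_i}$ has at least one positive eigenvalue, and $\sigma^B_-(M)$ is the number of $i \in [k]$ such that $M_{B_i}$ has at least one negative eigenvalue. *)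

(* Defs.v *)
From mathcomp Require Import all_boot all_order all_algebra.
From mathcomp Require Import boolp reals.

Set Implicit Arguments.
Unset Strict Implicit.
Unset Printing Implicit Defensive.

Import Order.TTheory GRing.Theory Num.Theory.
Local Open Scope ring_scope.

Definition block_partition (n k : nat) (B : 'I_k -> {set 'I_n}) : Prop :=
  [/\ forall i, B i != set0,
      forall i j, i != j -> [disjoint B i & B j]
    & \bigcup_i B i = [set: 'I_n]].

Section BlockMatrices.
Variables (R : realType) (n : nat).

Definition mxdot (M N : 'M[R]_n) : R := \tr (M^T *m N).

Definition psdmx (M : 'M[R]_n) : Prop :=
  M \is symmetricmx /\ forall v : 'cV[R]_n, 0 <= (v^T *m M *m v) 0 0.

Definition principal_submx (S : {set 'I_n}) (M : 'M[R]_n) : 'M[R]_#|S| :=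
  mxsub (@enum_val _ (mem S)) (@enum_val _ (mem S)) M.

Variables (k : nat) (B : 'I_k -> {set 'I_n}).

(* Block matrices are by definition elements of S^n, hence symmetric. *)
Definition sym_blockmx (M : 'M[R]_n) : Prop :=
  M \is symmetricmx /\
  forall s t, ~ (exists i, s \in B i /\ t \in B i) -> M s t = 0.

Definition sigmaB_pos (M : 'M[R]_n) : nat :=
  #|[set i | `[< exists a, eigenvalue (principal_submx (B i) M) a /\ 0 < a >]]|.

Definition sigmaB_neg (M : 'M[R]_n) : nat :=
  #|[set i | `[< exists a, eigenvalue (principal_submx (B i) M) a /\ a < 0 >]]|.

Definition feasible (m : nat) (A : 'I_m -> 'M[R]_n) (X0 X : 'M[R]_n) : Prop :=
  [/\ psdmx X, sym_blockmx X & forall i, mxdot (A i) X = mxdot (A i) X0].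

End BlockMatrices.

(* Main.v *)
Require Import Defs.
From mathcomp Require Import all_boot all_order all_algebra.
From mathcomp Require Import boolp reals.
From mathcomp Require Import complex.

(** Two positive semidefinite block matrices X0 and X have the same values
    A_i . X exactly when their difference V = X0 - X is orthogonal to all the
    A_i, so uniqueness of the feasible point is a condition on V alone.

    If X0 and X are positive semidefinite, a block in which X0 - X has a
    positive eigenvalue must be a block in which X0 is nonzero, hence has a
    positive eigenvalue; thus sigma_+(X0 - X) <= sigma_+(X0)
    ([sigmaB_pos_psd_sub]).  A second feasible point for some X0 with
    sigma_+(X0) <= t would therefore give a nonzero V in the kernel with
    sigma_+(V) <= t.  Conversely, splitting each block of V into its positive
    and negative parts gives V = P - N with P and N positive semidefinite
    block matrices and sigma_+(P) <= sigma_+(V)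
    ([sym_blockmx_posneg_decomp]); if V is a nonzero element of the kernel
    with sigma_+(V) <= t, then P and N are two distinct feasible points for
    X0 = P.  The bound on sigma_- is the bound on sigma_+ for - V.

    The spectral input is that a real polynomial vanishing at the real
    eigenvalues of a real symmetric matrix M annihilates M
    ([symmetric_minpoly_real]), obtained by diagonalizing M over the complex
    numbers.  The positive part of M is then g(M)^2, where the polynomial g
    interpolates the function a |-> sqrt (max a 0) on the spectrum. *)

Set Implicit Arguments.
Unset Strict Implicit.
Unset Printing Implicit Defensive.

Import Order.TTheory GRing.Theory Num.Theory.
Local Open Scope ring_scope.

(** * Matrices and polynomials over a field *)

Lemma symmetricmxE (R : fieldType) n (M : 'M[R]_n) :
  (M \is symmetricmx) = (M^T == M).
Proof. by rewrite is_hermitianmxE expr0 scale1r map_mx_id // eq_sym. Qed.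

Lemma trmx_horner_mx (R : comNzRingType) n (M : 'M[R]_n.+1) (p : {poly R}) :
  (horner_mx M p)^T = horner_mx M^T p.
Proof.
elim/poly_ind: p => [|p c IHp]; first by rewrite !rmorph0 trmx0.
rewrite !rmorphD !rmorphM /= !horner_mx_X !horner_mx_C linearD /= tr_scalar_mx.
rewrite trmx_mul IHp; congr (_ + _).
exact: (comm_mx_horner p (comm_mx_refl M^T)).
Qed.

Lemma poly_interpolation (F : fieldType) (f : F -> F) (s : seq F) :
  exists p : {poly F}, {in s, forall x, p.[x] = f x}.
Proof.
elim: s => [|a s [p Hp]]; first by exists 0.
have [as_|asN] := boolP (a \in s).
  by exists p => x; rewrite inE => /predU1P[->|]; exact: Hp.
pose q := \prod_(b <- s) ('X - b%:P).
have qa : q.[a] != 0 by rewrite -rootE root_prod_XsubC.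
exists (p + ((f a - p.[a]) / q.[a]) *: q) => x.
rewrite inE hornerD hornerZ => /predU1P[->|xs].
  by rewrite divfK // addrC subrK.
have /eqP-> : q.[x] == 0 by rewrite -rootE root_prod_XsubC.
by rewrite mulr0 addr0 Hp.
Qed.

(** * Spectral theory of real symmetric matrices *)

Section RealSymmetric.
Variable R : realType.

(** There is a list s of real eigenvalues of M such that M is annihilated by
    every real polynomial vanishing on s; having the eigenvalues as a list
    makes [poly_interpolation] applicable. *)
Lemma symmetric_minpoly_real n (M : 'M[R]_n.+1) : M \is symmetricmx ->
  exists2 s : seq R, {in s, forall a, eigenvalue M a} &
    forall p, {in s, forall a, p.[a] = 0} -> horner_mx M p = 0.
Proof.
rewrite symmetricmxE => /eqP Msym.
pose C : numClosedFieldType := complex R.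
pose toC : {rmorphism R -> C} := real_complex R.
pose MC := map_mx toC M.
have MCherm : MC \is hermsymmx.
  apply: realsym_hermsym.
    by rewrite symmetricmxE map_trmx Msym.
  by apply/mxOverP => i j; rewrite mxE complex_real eqxx.
have /orthomx_spectralP MCE := hermitian_normalmx MCherm.
set U := spectralmx MC in MCE; set d := spectral_diag MC in MCE.
have Uunit : U \in unitmx by exact: spectral_unit.
have /fin_all_exists[r dE] i : exists a, d 0 i = toC a.
  by apply/complex_realP; exact: (mxOverP (hermitian_spectral_diag_real MCherm)).
(* Row i of U is an eigenvector of MC for the eigenvalue r i; the real
   characteristic polynomial brings that eigenvalue back to M. *)
exists [seq r i | i : 'I_n.+1].
  move=> _ /mapP[i _ ->].
  rewrite eigenvalue_root_char -(fmorph_root toC) map_char_poly -dE.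
  rewrite -eigenvalue_root_char; apply/eigenvalueP; exists (row i U).
    rewrite -row_mul -/MC {1}MCE !mulmxA mulmxV // mul1mx.
    by apply/rowP => j; rewrite mxE mul_diag_mx !mxE.
  apply/eqP => Ui0; have : delta_mx 0 i *m U *m invmx U = 0 :> 'rV_n.+1.
    by rewrite -rowE Ui0 mul0mx.
  rewrite mulmxK // => /rowP /(_ i); rewrite !mxE !eqxx => /eqP.
  by rewrite oner_eq0.
move=> p p0; apply: (@map_mx_inj _ _ toC); rewrite map_horner_mx map_mx0 -/MC MCE.
rewrite horner_mx_uconjC // horner_mx_diag.
suff -> : map_mx (horner (map_poly toC p)) d = 0.
  by rewrite linear0 mulmx0 mul0mx.
apply/rowP => i; rewrite !mxE dE horner_map p0 ?rmorph0 //.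
by apply/mapP; exists i; rewrite ?mem_enum.
Qed.

Lemma psdmx_gram m n (G : 'M[R]_(m, n)) : psdmx (G^T *m G).
Proof.
split=> [|v]; first by rewrite symmetricmxE trmx_mul trmxK.
rewrite mulmxA -mulmxA -trmx_mul mxE; apply: sumr_ge0 => i _.
by rewrite mxE -expr2 sqr_ge0.
Qed.

Lemma psdmx0 n : psdmx (0 : 'M[R]_n).
Proof. by have := psdmx_gram (0 : 'M[R]_n); rewrite mulmx0. Qed.

Lemma psdmxD n (M N : 'M[R]_n) : psdmx M -> psdmx N -> psdmx (M + N).
Proof.
move=> [Ms M0] [Ns N0]; split=> [|v].
  by move: Ms Ns; rewrite !symmetricmxE linearD /= => /eqP-> /eqP->.
by rewrite mulmxDr mulmxDl mxE addr_ge0.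
Qed.

Lemma psdmx_conj m n (J : 'M[R]_(m, n)) (M : 'M[R]_m) :
  psdmx M -> psdmx (J^T *m M *m J).
Proof.
rewrite /psdmx !symmetricmxE => -[/eqP Ms M0]; split=> [|v].
  by rewrite !trmx_mul trmxK Ms mulmxA.
by have := M0 (J *m v); rewrite trmx_mul !mulmxA.
Qed.

Lemma psdmx_eigenvalue_ge0 n (M : 'M[R]_n) a :
  psdmx M -> eigenvalue M a -> 0 <= a.
Proof.
move=> [_ M0] /eigenvalueP[v vM v0].
have vv : 0 < (v *m v^T) 0 0.
  rewrite lt_neqAle eq_sym; apply/andP; split; last first.
    by rewrite mxE sumr_ge0 // => i _; rewrite mxE -expr2 sqr_ge0.
  apply: contra v0 => /eqP; rewrite mxE => /psumr_eq0P vv0.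
  apply/eqP/rowP => i; apply/eqP; rewrite mxE -sqrf_eq0 expr2.
  have /= := vv0 _ i isT; rewrite mxE => -> // j _.
  by rewrite mxE -expr2 sqr_ge0.
by have := M0 v^T; rewrite trmxK vM -scalemxAl mxE pmulr_lge0.
Qed.

(** M has at least one positive eigenvalue; this is the condition on each block
    counted by [sigmaB_pos]. *)
Definition has_pos_eigenvalue n (M : 'M[R]_n) :=
  exists a, eigenvalue M a /\ 0 < a.

(** P and N are the positive and negative parts of M. The last clause, which
    fails for a decomposition such as (P + 1) - (N + 1), is what bounds the
    number of positive blocks of P. *)
Lemma symmetric_posneg_decomp n (M : 'M[R]_n) : M \is symmetricmx ->
  exists P N : 'M[R]_n, [/\ psdmx P, psdmx N, M = P - N &
    ~ has_pos_eigenvalue M -> P = 0].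
Proof.
case: n M => [|n] M Msym.
  exists 0, 0; split=> //; try exact: psdmx0.
  by rewrite [M]thinmx0 subr0.
have [s sM Ms] := symmetric_minpoly_real Msym.
(* Num.sqrt is 0 on negative numbers, so g(a)^2 and h(a)^2 are the positive
   and negative parts of a. *)
have [g gE] := poly_interpolation (fun a => Num.sqrt a) s.
have [h hE] := poly_interpolation (fun a => Num.sqrt (- a)) s.
have sq p : (horner_mx M p)^T *m horner_mx M p = horner_mx M (p * p).
  move: Msym; rewrite symmetricmxE trmx_horner_mx => /eqP->.
  by rewrite rmorphM.
exists (horner_mx M (g * g)), (horner_mx M (h * h)); split.
- by rewrite -sq; exact: psdmx_gram.
- by rewrite -sq; exact: psdmx_gram.
- apply/eqP; rewrite -subr_eq0 -{1}(horner_mx_X M) -!rmorphB /=; apply/eqP.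
  apply: Ms => a sa; rewrite !hornerE gE // hE // -!expr2.
  have [a0|a0] := leP 0 a.
    rewrite sqr_sqrtr // (_ : Num.sqrt (- a) = 0) ?expr0n ?subr0 ?subrr //.
    by apply/eqP; rewrite sqrtr_eq0 oppr_le0.
  rewrite (ler0_sqrtr (ltW a0)) sqr_sqrtr ?oppr_ge0 ?ltW //.
  by rewrite expr0n sub0r opprK subrr.
- move=> Mpos; apply: Ms => a sa; rewrite hornerM gE // ler0_sqrtr ?mul0r //.
  by rewrite leNgt; apply/negP => a0; apply: Mpos; exists a; split=> //; exact: sM.
Qed.

Lemma psdmx_eq0 n (M : 'M[R]_n) : psdmx M -> ~ has_pos_eigenvalue M -> M = 0.
Proof.
case: n M => [|n] M Mpsd Mpos; first by rewrite [M]thinmx0.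
have [s sM Ms] := symmetric_minpoly_real Mpsd.1.
rewrite -(horner_mx_X M); apply: Ms => a sa; rewrite hornerX.
apply: le_anti; rewrite (psdmx_eigenvalue_ge0 Mpsd (sM a sa)) andbT.
by rewrite leNgt; apply/negP => a0; apply: Mpos; exists a; split=> //; exact: sM.
Qed.

Lemma eigenvalueN n (M : 'M[R]_n) a : eigenvalue (- M) a = eigenvalue M (- a).
Proof.
apply/eigenvalueP/eigenvalueP => -[v vM v0]; exists v => //.
  by rewrite scaleNr -vM mulmxN opprK.
by rewrite mulmxN vM scaleNr opprK.
Qed.

(** * Principal submatrices and coordinate selection *)

(** The coordinate map from R^n onto R^S, as a matrix with #|S| rows. Its rows
    follow the enumeration of S used by [principal_submx], so that taking a
    principal submatrix is conjugation by it. *)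
Definition select_mx n (S : {set 'I_n}) : 'M[R]_(#|S|, n) :=
  rowsub (@enum_val _ (mem S)) 1%:M.

Lemma select_mxE n (S : {set 'I_n}) a s :
  select_mx S a s = (enum_val a == s)%:R.
Proof. by rewrite !mxE. Qed.

Lemma principal_submxE n (S : {set 'I_n}) (M : 'M[R]_n) :
  principal_submx S M = select_mx S *m M *m (select_mx S)^T.
Proof.
rewrite mul_rowsub_mx mul1mx trmx_mxsub trmx1 mulmx_colsub mulmx1.
by rewrite -mxsubcr.
Qed.

Lemma principal_submxB n (S : {set 'I_n}) (M N : 'M[R]_n) :
  principal_submx S (M - N) = principal_submx S M - principal_submx S N.
Proof. by rewrite !principal_submxE mulmxBr mulmxBl. Qed.

Lemma psdmx_principal n (S : {set 'I_n}) (M : 'M[R]_n) :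
  psdmx M -> psdmx (principal_submx S M).
Proof.
by move=> /(psdmx_conj (select_mx S)^T); rewrite trmxK -principal_submxE.
Qed.

Lemma tr_select_mxK n (S : {set 'I_n}) :
  (select_mx S)^T *m select_mx S = diag_mx (\row_s (s \in S)%:R).
Proof.
apply/matrixP => s t; rewrite mxE [in RHS]mxE mxE.
under eq_bigr do rewrite mxE !select_mxE -natrM mulnb.
have [sS|sS] := boolP (s \in S).
  rewrite (bigD1 (enum_rank_in sS s)) //= enum_rankK_in // eqxx /=.
  rewrite big1 ?addr0 // => a neq_a.
  rewrite (_ : enum_val a == s = false) //; apply: contraNF neq_a => /eqP sa.
  by apply/eqP/enum_val_inj; rewrite enum_rankK_in.
rewrite mul0rn big1 // => a _; rewrite (_ : enum_val a == s = false) //.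
by apply: contraNF sS => /eqP<-; exact: enum_valP.
Qed.

Lemma select_mulmx_tr n (S T : {set 'I_n}) : [disjoint S & T] ->
  select_mx S *m (select_mx T)^T = 0.
Proof.
move=> dST; apply/matrixP => a b; rewrite !mxE big1 // => s _.
rewrite select_mxE mxE select_mxE.
have [sa|] := eqVneq (enum_val a); last by rewrite mul0r.
have [sb|] := eqVneq (enum_val b); last by rewrite mulr0.
have := disjointFr dST (enum_valP a); rewrite sa -sb.
by rewrite (enum_valP b).
Qed.

Lemma select_mxK_tr n (S : {set 'I_n}) : select_mx S *m (select_mx S)^T = 1%:M.
Proof.
apply/matrixP => a b; rewrite mul_rowsub_mx mul1mx !mxE.
by rewrite (inj_eq enum_val_inj) eq_sym.
Qed.

(** * Block matrices *)

Section Blocks.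
Variables (n k : nat) (B : 'I_k -> {set 'I_n}).
Hypothesis hB : block_partition B.

(** The block matrix with respect to B whose i-th diagonal block is Q i. *)
Definition block_sum (Q : forall i, 'M[R]_#|B i|) : 'M[R]_n :=
  \sum_i (select_mx (B i))^T *m Q i *m select_mx (B i).

Lemma principal_block_sum Q i : principal_submx (B i) (block_sum Q) = Q i.
Proof.
have [_ dB _] := hB.
rewrite principal_submxE mulmx_sumr mulmx_suml (bigD1 i) //= big1 ?addr0.
  by rewrite !mulmxA select_mxK_tr mul1mx -mulmxA select_mxK_tr mulmx1.
move=> j neq_ji; rewrite !mulmxA select_mulmx_tr ?mul0mx //.
by apply: dB; rewrite eq_sym.
Qed.

Lemma sym_blockmxB M N : sym_blockmx B M -> sym_blockmx B N ->
  @sym_blockmx R n k B (M - N).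
Proof.
rewrite /sym_blockmx !symmetricmxE.
move=> [/eqP Ms M0] [/eqP Ns N0]; split; first by rewrite linearB /= Ms Ns.
by move=> s t st; rewrite !mxE M0 // N0 // subrr.
Qed.

Lemma block_sum_sym Q : (forall i, Q i \is symmetricmx) ->
  sym_blockmx B (block_sum Q).
Proof.
move=> Qs; split.
  rewrite symmetricmxE linear_sum; apply/eqP; apply: eq_bigr => i _ /=.
  have := Qs i; rewrite symmetricmxE => /eqP Qi.
  by rewrite !trmx_mul trmxK Qi mulmxA.
move=> s t st; rewrite summxE big1 // => i _.
rewrite mxE big1 // => b _; rewrite mxE big_distrl /= big1 // => a _.
rewrite mxE !select_mxE; have [sa|] := eqVneq (enum_val a); last by rewrite !mul0r.
have [tb|] := eqVneq (enum_val b); last by rewrite mulr0.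
by case: st; exists i; rewrite -sa -tb !enum_valP.
Qed.

Lemma block_sum_psd Q : (forall i, psdmx (Q i)) -> psdmx (block_sum Q).
Proof.
by move=> Qpsd; apply: big_ind => [||i _];
  [exact: psdmx0|exact: psdmxD|exact: psdmx_conj].
Qed.

Lemma block_sumB P Q :
  block_sum (fun i => P i - Q i) = block_sum P - block_sum Q.
Proof.
by rewrite -sumrB; apply: eq_bigr => i _; rewrite mulmxBr mulmxBl.
Qed.

Lemma block_sum_principal M : sym_blockmx B M ->
  M = block_sum (fun i => principal_submx (B i) M).
Proof.
have [_ dB _] := hB.
move=> [_ M0]; apply/matrixP => s t; rewrite summxE.
under eq_bigr => i _.
  rewrite principal_submxE !mulmxA tr_select_mxK -mulmxA tr_select_mxK.
  rewrite mul_mx_diag mul_diag_mx !mxE.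
  over.
(* When s and t lie in a common block, only that block contributes. *)
have [[i [si ti]]|/M0 Mst] := pselect (exists i, s \in B i /\ t \in B i).
  rewrite (bigD1 i) //= si ti mulr1 mul1r big1 ?addr0 // => j neq_ji.
  by rewrite (disjointFl (dB _ _ neq_ji) si) !mul0r.
by rewrite Mst big1 // => i _; rewrite mulr0 mul0r.
Qed.

Lemma sigmaB_negE (M : 'M[R]_n) : sigmaB_neg B M = sigmaB_pos B (- M).
Proof.
apply: eq_card => i; rewrite !inE; apply: asbool_equiv_eq.
rewrite -[- M]sub0r principal_submxB.
have -> : principal_submx (B i) 0 = 0 :> 'M[R]_ _.
  by rewrite principal_submxE mulmx0 mul0mx.
rewrite sub0r; split=> -[a [Ma a0]]; exists (- a).
  by rewrite eigenvalueN opprK oppr_gt0.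
by rewrite -eigenvalueN oppr_lt0.
Qed.

Lemma leq_sigmaB_pos (M N : 'M[R]_n) :
  (forall i, has_pos_eigenvalue (principal_submx (B i) M) ->
             has_pos_eigenvalue (principal_submx (B i) N)) ->
  (sigmaB_pos B M <= sigmaB_pos B N)%N.
Proof.
move=> MN; apply/subset_leq_card/subsetP => i; rewrite !inE => /asboolP Mi.
by apply/asboolP; exact: MN.
Qed.

(** In a block where M has no positive eigenvalue, M is zero, so that M - N is
    negative semidefinite there. *)
Lemma sigmaB_pos_psd_sub (M N : 'M[R]_n) : psdmx M -> psdmx N ->
  (sigmaB_pos B (M - N) <= sigmaB_pos B M)%N.
Proof.
move=> Mpsd Npsd; apply: leq_sigmaB_pos => i; rewrite principal_submxB => MNi.
apply: contrapT => /(psdmx_eq0 (psdmx_principal (B i) Mpsd)) Mi0.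
case: MNi => a []; rewrite Mi0 sub0r eigenvalueN => /psdmx_eigenvalue_ge0.
by move=> /(_ (psdmx_principal (B i) Npsd)); rewrite oppr_ge0 leNgt => /negP.
Qed.

Lemma sym_blockmx_posneg_decomp V : sym_blockmx B V ->
  exists P N : 'M[R]_n, [/\ psdmx P /\ sym_blockmx B P,
    psdmx N /\ sym_blockmx B N, V = P - N
    & (sigmaB_pos B P <= sigmaB_pos B V)%N].
Proof.
move=> VB.
have Vs i : principal_submx (B i) V \is symmetricmx.
  have [] := VB; rewrite !symmetricmxE principal_submxE => /eqP Vs _.
  by rewrite !trmx_mul trmxK Vs mulmxA.
pose decomp i (PN : 'M[R]_#|B i| * 'M[R]_#|B i|) := [/\ psdmx PN.1, psdmx PN.2,
  principal_submx (B i) V = PN.1 - PN.2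
  & ~ has_pos_eigenvalue (principal_submx (B i) V) -> PN.1 = 0].
have /fin_all_exists[PN PNE] i : exists PN, decomp i PN.
  by have [P [N PN]] := symmetric_posneg_decomp (Vs i); exists (P, N).
exists (block_sum (fun i => (PN i).1)), (block_sum (fun i => (PN i).2)); split.
- split; [apply: block_sum_psd|apply: block_sum_sym] => i; case: (PNE i) => //.
  by case.
- split; [apply: block_sum_psd|apply: block_sum_sym] => i; case: (PNE i) => //.
  by move=> _ [].
- rewrite -block_sumB {1}(block_sum_principal VB); apply: eq_bigr => i _.
  by case: (PNE i) => _ _ ->.
- apply: leq_sigmaB_pos => i; rewrite principal_block_sum => Pi.
  apply: contrapT => Vi; have [_ _ _ /(_ Vi) Pi0] := PNE i.
  case: Pi => a []; rewrite Pi0 => /eigenvalueP[v].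
  by rewrite mulmx0 => /esym/eqP; rewrite scaler_eq0 => /orP[/eqP->|/eqP->];
    rewrite ?ltxx ?eqxx.
Qed.

End Blocks.
End RealSymmetric.

Theorem theorem4p1 (R : realType) (n k m : nat) (B : 'I_k -> {set 'I_n})
    (hB : block_partition B)
    (A : 'I_m -> 'M[R]_n) (hA : forall i, sym_blockmx B (A i)) (t : nat) :
  (forall X0 : 'M[R]_n, psdmx X0 -> sym_blockmx B X0 ->
     (sigmaB_pos B X0 <= t)%N ->
     exists! X : 'M[R]_n, feasible B A X0 X)
  <->
  (forall V : 'M[R]_n, sym_blockmx B V -> V != 0 ->
     (forall i, mxdot (A i) V = 0) ->
     (t < sigmaB_pos B V)%N /\ (t < sigmaB_neg B V)%N).
Proof.
have mxdotB (M N P : 'M[R]_n) : mxdot M (N - P) = mxdot M N - mxdot M P.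
  by rewrite /mxdot mulmxBr linearB.
split=> [uniqX V VB V0 AV | sigV X0 X0psd X0B X0t].
  (* Applied to V for sigma_+ and to - V for sigma_-. *)
  have pos W : sym_blockmx B W -> W != 0 -> (forall i, mxdot (A i) W = 0) ->
      (t < sigmaB_pos B W)%N.
    move=> WB W0 AW.
    have [P [N [[Ppsd PB] [Npsd NB] WE sPW]]] := sym_blockmx_posneg_decomp hB WB.
    rewrite ltnNge; apply: contra W0 => sWt.
    have [X [_ uX]] := uniqX P Ppsd PB (leq_trans sPW sWt).
    rewrite WE subr_eq0 -(uX P) ?(uX N) //; split=> // i.
    by apply/esym/eqP; rewrite -subr_eq0 -mxdotB -WE AW.
  split; first exact: pos.
  rewrite sigmaB_negE; apply: pos.
  - rewrite -sub0r; apply: sym_blockmxB => //.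
    by split=> [|s u _]; rewrite ?symmetricmxE ?trmx0 ?mxE.
  - by rewrite oppr_eq0.
  - by move=> i; rewrite -sub0r mxdotB AV subr0 /mxdot mulmx0 linear0.
exists X0; split=> [|X [Xpsd XB AX]]; first by split.
apply/eqP; rewrite -subr_eq0; apply/negP => /negP V0.
have [|//|] := sigV (X0 - X) _ V0.
- exact: sym_blockmxB.
- by move=> i; rewrite mxdotB AX subrr.
- by rewrite ltnNge (leq_trans (sigmaB_pos_psd_sub B X0psd Xpsd) X0t).
Qed.
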